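(* Let $k,t$ be integers with $k\in\{5,6\}$, $k\geq t+1$ and $t\geq 3$, and let $H$ be a non-empty graph of order $t$. Then $\operatorname{gr}_k(P_5:H)=5$.
   Context: All graphs are finite, simple and undirected; a graph is non-empty if it has at least one edge; the order of a graph is its number of vertices. $K_n$ is the complete graph on $n$ vertices and $P_5$ is the path with $5$ vertices and $4$ edges. A $k$-edge-coloring assigns to each edge one of $k$ colors; all $k$-edge-colorings are assumed exact, i.e. each of the $k$ colors is used at least once. An edge-colored graph is rainbow if all its edges have different colors and monochromatic if all its edges have a single color. A copy of a graph means a (not necessarily induced) subgraph isomorphic to it. For non-empty graphs $G,H$ and a positive integer $k$, the Gallai-Ramsey number $\operatorname{gr}_k(G:H)$ is the minimum integer $N$ with $\binom{N}{2}\geq k$ (so that $K_N$ admits a $k$-edge-coloring) such that for all $n\geq N$, every $k$-edge-coloring of $K_n$ contains either a rainbow copy of $G$ or a monochromatic copy of $H$.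
   Formalization: The formal theorem excludes graphs H of order t ≤ 4 with exactly one edge (K_2 plus one or two isolated vertices); for these every coloring of K_n with n ≥ 4 has a monochromatic copy of H, so gr_k(P_5:H) = 4 and the claim as stated fails. *)

(* Defs.v *)
From mathcomp Require Import all_boot.

Set Implicit Arguments.
Unset Strict Implicit.
Unset Printing Implicit Defensive.

Record sgraph := SGraph {
  vertex :> finType;
  adj : rel vertex;
  adj_sym : symmetric adj;
  adj_irrefl : irreflexive adj }.

Definition edges (G : sgraph) : {set {set G}} :=
  [set [set p.1; p.2] | p in [set p : G * G | adj p.1 p.2]].

Definition nonempty (G : sgraph) : bool := edges G != set0.

Lemma complete_sym n : symmetric [rel x y : 'I_n | x != y].
Proof. by move=> x y /=; rewrite eq_sym. Qed.

Lemma complete_irrefl n : irreflexive [rel x y : 'I_n | x != y].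
Proof. by move=> x /=; rewrite eqxx. Qed.

Definition complete_graph (n : nat) : sgraph :=
  SGraph (@complete_sym n) (@complete_irrefl n).

Lemma path_sym n : symmetric [rel x y : 'I_n | (x.+1 == y) || (y.+1 == x)].
Proof. by move=> x y /=; rewrite orbC. Qed.

Lemma path_irrefl n : irreflexive [rel x y : 'I_n | (x.+1 == y) || (y.+1 == x)].
Proof. by move=> x /=; rewrite orbb gtn_eqF. Qed.

Definition path_graph (n : nat) : sgraph :=
  SGraph (@path_sym n) (@path_irrefl n).

(* The pair (W, F) is a subgraph of G isomorphic to H, through the bijection f
   from the vertices of H onto W; the endpoints of F then lie in W. *)
Definition is_copy (H G : sgraph) (W : {set G}) (F : {set {set G}}) : Prop :=
  F \subset edges G /\
  exists f : H -> G,
    [/\ injective f, W = f @: [set: H] & F = [set f @: e | e : {set H} in edges H]].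

(* A coloring is a function on all vertex sets of which only the values on
   edges matter. *)
Definition exact_coloring (k : nat) (G : sgraph) (c : {set G} -> 'I_k) : Prop :=
  forall i : 'I_k, exists2 e, e \in edges G & c e = i.

Definition rainbow (T : finType) (k : nat) (c : {set T} -> 'I_k)
    (F : {set {set T}}) : Prop :=
  {in F &, injective c}.

Definition monochromatic (T : finType) (k : nat) (c : {set T} -> 'I_k)
    (F : {set {set T}}) : Prop :=
  exists i : 'I_k, forall e, e \in F -> c e = i.

Definition has_rainbow_copy (k : nat) (K : sgraph) (c : {set K} -> 'I_k)
    (G : sgraph) : Prop :=
  exists (W : {set K}) (F : {set {set K}}), is_copy G W F /\ rainbow c F.

Definition has_mono_copy (k : nat) (K : sgraph) (c : {set K} -> 'I_k)
    (H : sgraph) : Prop :=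
  exists (W : {set K}) (F : {set {set K}}), is_copy H W F /\ monochromatic c F.

Definition gr_bound (k : nat) (G H : sgraph) (N : nat) : Prop :=
  k <= 'C(N, 2) /\
  forall n, N <= n -> forall c : {set complete_graph n} -> 'I_k,
    exact_coloring c -> has_rainbow_copy c G \/ has_mono_copy c H.

(* gr_k(G : H) = N *)
Definition is_gallai_ramsey (k : nat) (G H : sgraph) (N : nat) : Prop :=
  gr_bound k G H N /\ forall M, gr_bound k G H M -> N <= M.

(* Main.v *)
Require Import Defs.
From mathcomp Require Import all_boot.

Set Implicit Arguments.
Unset Strict Implicit.
Unset Printing Implicit Defensive.

(** Let d be a colouring of a complete graph without rainbow P_5, using at
    least 5 colours.
    - If some vertex a sees four colours, then an edge of a colour different
      from those of a rainbow star K_{1,4} at a joins two of its leaves (for a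
      suitable star), and this forces all edges avoiding a to have one colour.
    - Otherwise every vertex sees at most three colours, and in fact at most
      two: a vertex a seeing 1, 2, 3 misses two colours 4 and 5, and edges of
      these colours, whether they meet or not, give a rainbow P_5 with a. The
      palettes are then pairwise intersecting sets of size at most two covering
      five colours, so they share a colour m, and one vertex for each other
      colour gives a clique of colour m.
    Either way there is a monochromatic clique on k - 1 vertices, which contains
    H. On four vertices there is no P_5, and a colouring of K_4 that merges at
    most one pair of edges (disjoint or adjacent, at our choice) avoids H. *)

(** * Rainbow paths and palettes *)

Lemma exists_notin (T : finType) (s : seq T) :
  size s < #|T| -> exists x, x \notin s.
Proof.
move=> sT; apply/existsP; apply: contraLR sT => /existsPn all_s.
rewrite -leqNgt (leq_trans _ (card_size s)) //.
by apply: subset_leq_card; apply/subsetP => x _; have := all_s x; rewrite negbK.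
Qed.

(** A copy of P_5 is encoded by its five vertices in path order, [pairmap] giving the colours of its
    four edges. *)
Definition rainbow_P5_free (T C : eqType) (d : T -> T -> C) : Prop :=
  forall x p, size p = 4 -> uniq (x :: p) -> ~~ uniq (pairmap d x p).

(** The vertex [x] is left out because [d x x] is not the colour of an edge. *)
Definition palette (T C : finType) (d : T -> T -> C) (x : T) : {set C} :=
  [set d x y | y in [set~ x]].

Lemma paletteP (T C : finType) (d : T -> T -> C) (x : T) (i : C) :
  reflect (exists2 y, y <> x & d x y = i) (i \in palette d x).
Proof.
apply: (iffP imsetP) => -[y].
  by rewrite !inE => /eqP nyx ->; exists y.
by move=> /eqP nyx <-; exists y; rewrite ?inE.
Qed.

Lemma no_rainbow_P5 (T C : eqType) (d : T -> T -> C) (v0 v1 v2 v3 v4 : T) :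
  rainbow_P5_free d ->
  v0 <> v1 -> v0 <> v2 -> v0 <> v3 -> v0 <> v4 -> v1 <> v2 -> v1 <> v3 ->
  v1 <> v4 -> v2 <> v3 -> v2 <> v4 -> v3 <> v4 ->
  d v0 v1 <> d v1 v2 -> d v0 v1 <> d v2 v3 -> d v0 v1 <> d v3 v4 ->
  d v1 v2 <> d v2 v3 -> d v1 v2 <> d v3 v4 -> d v2 v3 <> d v3 v4 -> False.
Proof.
move=> free *.
have /negP[] := free v0 [:: v1; v2; v3; v4] erefl
  ltac:(by rewrite /= !inE !negb_or; do ![apply/andP; split] => //; apply/eqP).
by rewrite /= !inE !negb_or; do ![apply/andP; split] => //; apply/eqP.
Qed.

Definition clique_color (T C : finType) (d : T -> T -> C) (A : {set T}) (m : C) :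
    Prop :=
  {in A &, forall x y, x <> y -> d x y = m}.

(** Contradiction from the rainbow path through the five vertices in this order. As [congruence]
    does not know that [d] is symmetric, the needed instances of [dC] are put into the context
    before its uses. *)
Ltac rainbow_path free v0 v1 v2 v3 v4 :=
  exfalso;
  apply: (no_rainbow_P5 (v0 := v0) (v1 := v1) (v2 := v2) (v3 := v3) (v4 := v4)
                        free);
  congruence.

Record star4 (T C : finType) (d : T -> T -> C) (a x1 x2 x3 x4 : T)
    (s1 s2 s3 s4 : C) : Prop := Star4 {
  _ : [/\ a <> x1, a <> x2, a <> x3 & a <> x4];
  _ : [/\ d a x1 = s1, d a x2 = s2, d a x3 = s3 & d a x4 = s4];
  _ : [/\ s1 <> s2, s1 <> s3, s1 <> s4 & [/\ s2 <> s3, s2 <> s4 & s3 <> s4]]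
}.

(** * Vertices that see at least four colours *)

Section RainbowP5Free.
Variables (T C : finType) (d : T -> T -> C).
Hypotheses (free : rainbow_P5_free d) (dC : forall x y, d x y = d y x).

(** A path can run along x1x2, through [a], and along x3x4. The two spokes it uses can be chosen to
    avoid the colour of x3x4, so only the new colour is left for x3x4. *)
Lemma new_color_opposite a x1 x2 x3 x4 s1 s2 s3 s4 :
  star4 d a x1 x2 x3 x4 s1 s2 s3 s4 ->
  d x1 x2 \notin [:: s1; s2; s3; s4] -> d x3 x4 = d x1 x2.
Proof.
case=> -[? ? ? ?] [? ? ? ?] [? ? ? [? ? ?]].
rewrite !inE !negb_or => /and4P[/eqP ? /eqP ? /eqP ? /eqP ?].
apply/eqP; case: eqP => // ?.
have [[? ?] [? ?]] := (dC x1 x2, dC x3 x4, (dC a x1, dC a x2)).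
have [? ?] := (dC a x3, dC a x4).
have [?|?] := d x3 x4 =P s1; first by rainbow_path free x1 x2 a x3 x4.
have [?|?] := d x3 x4 =P s2; first by rainbow_path free x2 x1 a x3 x4.
have [?|?] := d x3 x4 =P s3; first by rainbow_path free x2 x1 a x4 x3.
by rainbow_path free x2 x1 a x3 x4.
Qed.

(** Besides the new colour, the path x3, a, x1, x2, x4 leaves only [s1] and [s3] for x2x4. In each
    of these cases every colour of x1x3 completes a rainbow path. *)
Lemma new_color_adjacent a x1 x2 x3 x4 s1 s2 s3 s4 :
  star4 d a x1 x2 x3 x4 s1 s2 s3 s4 ->
  d x1 x2 \notin [:: s1; s2; s3; s4] -> d x2 x4 = d x1 x2.
Proof.
move=> st new; have := new_color_opposite st new; move: st new.
case=> -[? ? ? ?] [? ? ? ?] [? ? ? [? ? ?]].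
rewrite !inE !negb_or => /and4P[/eqP ? /eqP ? /eqP ? /eqP ?] ?.
apply/eqP; case: eqP => // ?.
have [[? ?] [? ?]] := (dC x1 x2, dC x3 x4, (dC a x1, dC a x2)).
have [[? ?] [? ?]] := (dC a x3, dC a x4, (dC x1 x3, dC x2 x4)).
have [?|?] := d x2 x4 =P s1.
  have [?|?] := d x1 x3 =P s4; first by rainbow_path free a x2 x4 x3 x1.
  have [?|?] := d x1 x3 =P s2; first by rainbow_path free x2 x4 a x3 x1.
  have [?|?] := d x1 x3 =P d x1 x2; first by rainbow_path free x2 x4 a x3 x1.
  by rainbow_path free x4 a x2 x1 x3.
have [?|?] := d x2 x4 =P s3; last by rainbow_path free x3 a x1 x2 x4.
have [?|?] := d x1 x3 =P s2; first by rainbow_path free a x4 x2 x1 x3.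
have [?|?] := d x1 x3 =P s4; first by rainbow_path free x4 x2 a x1 x3.
have [?|?] := d x1 x3 =P d x1 x2; first by rainbow_path free x4 x2 a x1 x3.
by rainbow_path free x4 a x2 x1 x3.
Qed.

Lemma star4_swap12 a x1 x2 x3 x4 s1 s2 s3 s4 :
  star4 d a x1 x2 x3 x4 s1 s2 s3 s4 -> star4 d a x2 x1 x3 x4 s2 s1 s3 s4.
Proof. by case=> -[? ? ? ?] [? ? ? ?] [? ? ? [? ? ?]]; split; split; try split; congruence. Qed.

Lemma star4_swap34 a x1 x2 x3 x4 s1 s2 s3 s4 :
  star4 d a x1 x2 x3 x4 s1 s2 s3 s4 -> star4 d a x1 x2 x4 x3 s1 s2 s4 s3.
Proof. by case=> -[? ? ? ?] [? ? ? ?] [? ? ? [? ? ?]]; split; split; try split; congruence. Qed.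

(** The four relabellings of the star that keep the pair x1, x2 turn [new_color_adjacent] into the
    four edges between this pair and x3, x4. *)
Lemma new_color_star a x1 x2 x3 x4 s1 s2 s3 s4 :
  star4 d a x1 x2 x3 x4 s1 s2 s3 s4 ->
  d x1 x2 \notin [:: s1; s2; s3; s4] ->
  {in [:: x1; x2; x3; x4] &, forall y z, y <> z -> d y z = d x1 x2}.
Proof.
move=> st new; have st' := star4_swap34 st.
have new' : d x1 x2 \notin [:: s1; s2; s4; s3].
  by move: new; rewrite !inE [(_ == s4) || _]orbC.
have st12 := star4_swap12 st; have st12' := star4_swap12 st'.
have n12 : d x2 x1 \notin [:: s2; s1; s3; s4].
  by move: new; rewrite dC !inE !orbA [(_ == s2) || _]orbC.
have n12' : d x2 x1 \notin [:: s2; s1; s4; s3].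
  by move: new'; rewrite dC !inE !orbA [(_ == s2) || _]orbC.
have ? := new_color_opposite st new.
have ? := new_color_adjacent st new.
have ? := new_color_adjacent st' new'.
have ? := new_color_adjacent st12 n12.
have ? := new_color_adjacent st12' n12'.
have [[? ?] [? ?]] := (dC x1 x2, dC x3 x4, (dC x1 x4, dC x2 x3)).
have [? ?] := (dC x1 x3, dC x2 x4).
by move=> y z; rewrite !inE => /or4P[]/eqP -> /or4P[]/eqP ->; congruence.
Qed.

Lemma new_color_clique a x1 x2 x3 x4 s1 s2 s3 s4 :
  star4 d a x1 x2 x3 x4 s1 s2 s3 s4 ->
  d x1 x2 \notin [:: s1; s2; s3; s4] ->
  clique_color d [set~ a] (d x1 x2).
Proof.
move=> st new; have mono := new_color_star st new.
case: st new => -[? ? ? ?] [? ? ? ?] [? ? ? [? ? ?]].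
set m := d x1 x2 in mono *; move: m mono => m mono.
rewrite !inE !negb_or => /and4P[/eqP ? /eqP ? /eqP ? /eqP ?].
have E : [/\ x1 <> x2, x1 <> x3, x1 <> x4 & [/\ x2 <> x3, x2 <> x4 & x3 <> x4]].
  by do ?split; congruence.
case: E => ? ? ? [? ? ?].
have [E1 E2 E3 [E4 E5 E6]] : [/\ d x1 x2 = m, d x1 x3 = m, d x1 x4 = m &
    [/\ d x2 x3 = m, d x2 x4 = m & d x3 x4 = m]].
  by do ?split; apply: mono; rewrite ?inE ?eqxx ?orbT.
have [[? ?] ?] := (dC x1 x2, dC x1 x3, dC x1 x4).
have [[? ?] ?] := (dC x2 x3, dC x2 x4, dC x3 x4).
have [[? ?] [? ?]] := (dC a x1, dC a x2, (dC a x3, dC a x4)).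
(* Once [x] has edges of colour [m] to two leaves u, v, a path y, x, leaf, a, leaf can avoid the
   colour of yx on its spokes. This settles edges from outside vertices to leaves, and then edges
   between outside vertices. *)
have spread y x u v w : y <> a -> x <> a -> y <> x -> y <> u -> y <> v -> y <> w ->
    x <> u -> x <> v -> x <> w -> a <> u -> a <> v -> a <> w ->
    d u a <> d v a -> d u a <> d w a -> d v a <> d w a ->
    d u a <> m -> d v a <> m -> d w a <> m ->
    d x u = m -> d x v = m -> d y x = m.
  move=> *; have [[? ?] ?] := (dC a u, dC a v, dC a w).
  apply/eqP; case: eqP => // ?.
  have [?|?] := d y x =P d u a; first by rainbow_path free y x v a w.
  have [?|?] := d y x =P d v a; first by rainbow_path free y x u a w.
  by rainbow_path free y x u a v.
have leaf y x : y <> a -> y \notin [:: x1; x2; x3; x4] ->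
    x \in [:: x1; x2; x3; x4] -> d y x = m.
  rewrite !inE !negb_or => ? /and4P[/eqP ? /eqP ? /eqP ? /eqP ?].
  case/or4P=> /eqP->.
  - by apply: (spread y x1 x2 x3 x4); congruence.
  - by apply: (spread y x2 x1 x3 x4); congruence.
  - by apply: (spread y x3 x1 x2 x4); congruence.
  - by apply: (spread y x4 x1 x2 x3); congruence.
move=> y z; rewrite !in_setC1 => /eqP ya /eqP za yz.
have [yX|yX] := boolP (y \in [:: x1; x2; x3; x4]).
  have [zX|zX] := boolP (z \in [:: x1; x2; x3; x4]); first exact: mono.
  by rewrite dC; apply: leaf.
have [zX|zX] := boolP (z \in [:: x1; x2; x3; x4]); first exact: leaf.
have [z1 z2] : d z x1 = m /\ d z x2 = m by split; apply: leaf => //; rewrite ?inE ?eqxx ?orbT.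
move: yX zX; rewrite !inE !negb_or => /and4P[/eqP ? /eqP ? /eqP ? /eqP ?].
case/and4P=> /eqP ? /eqP ? /eqP ? /eqP ?.
by apply: (spread y z x1 x2 x3); congruence.
Qed.

(** If an edge between two leaves has neither spoke colour of its ends, it is new for some four of
    the five spokes. Otherwise each edge of the triangle x1, x2, x3 repeats a spoke colour of one of
    its ends, and a path x4, a, then around the triangle is rainbow. *)
Lemma five_color_clique a x1 x2 x3 x4 x5 :
  a <> x1 -> a <> x2 -> a <> x3 -> a <> x4 -> a <> x5 ->
  uniq [:: d a x1; d a x2; d a x3; d a x4; d a x5] ->
  exists m, clique_color d [set~ a] m.
Proof.
move=> ? ? ? ? ?; rewrite /= !inE !negb_or !andbT -!andbA.
do 9![case/andP=> /eqP ?]; move/eqP=> ?.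
have pair y1 y2 y3 y4 y5 t1 t2 t3 t4 t5 :
    star4 d a y1 y2 y3 y4 t1 t2 t3 t4 -> a <> y5 -> d a y5 = t5 ->
    t1 <> t5 -> t2 <> t5 -> t3 <> t5 -> t4 <> t5 ->
    (exists m, clique_color d [set~ a] m) \/ d y1 y2 = t1 \/ d y1 y2 = t2.
  case=> -[? ? ? ?] [? ? ? ?] [? ? ? [? ? ?]] ? ? ? ? ? ?.
  have [?|/eqP ?] := d y1 y2 =P t1; first by right; left.
  have [?|/eqP ?] := d y1 y2 =P t2; first by right; right.
  left; exists (d y1 y2).
  have [e|/eqP ?] := d y1 y2 =P t3.
    apply: (@new_color_clique a y1 y2 y4 y5 t1 t2 t4 t5).
      by split; split; try split; congruence.
    by rewrite !inE !negb_or; apply/and4P; split=> //; rewrite e; apply/eqP; congruence.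
  have [e|/eqP ?] := d y1 y2 =P t4.
    apply: (@new_color_clique a y1 y2 y3 y5 t1 t2 t3 t5).
      by split; split; try split; congruence.
    by rewrite !inE !negb_or; apply/and4P; split=> //; rewrite e; apply/eqP; congruence.
  apply: (@new_color_clique a y1 y2 y3 y4 t1 t2 t3 t4).
    by split; split; try split; congruence.
  by rewrite !inE !negb_or; apply/and4P; split.
have [//|p12] : (exists m, clique_color d [set~ a] m) \/ d x1 x2 = d a x1 \/ d x1 x2 = d a x2.
  by apply: (pair _ _ x3 x4 x5); do ?split; congruence.
have [//|p13] : (exists m, clique_color d [set~ a] m) \/ d x1 x3 = d a x1 \/ d x1 x3 = d a x3.
  by apply: (pair _ _ x2 x4 x5); do ?split; congruence.
have [//|p23] : (exists m, clique_color d [set~ a] m) \/ d x2 x3 = d a x2 \/ d x2 x3 = d a x3.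
  by apply: (pair _ _ x1 x4 x5); do ?split; congruence.
have [[? ?] ?] := (dC x1 x2, dC x1 x3, dC x2 x3).
have [[? ?] [? ?]] := (dC a x1, dC a x2, (dC a x3, dC a x4)).
case: p12 => ?.
  case: p13 => ?; last by rainbow_path free x4 a x2 x1 x3.
  case: p23 => ?; first by rainbow_path free x4 a x3 x2 x1.
  by rainbow_path free x4 a x2 x3 x1.
case: p23 => ?; last by rainbow_path free x4 a x1 x2 x3.
case: p13 => ?; first by rainbow_path free x4 a x3 x1 x2.
by rainbow_path free x4 a x1 x3 x2.
Qed.

Lemma rich_vertex_clique a :
  5 <= #|C| -> (forall i, exists x y, x <> y /\ d x y = i) ->
  4 <= #|palette d a| -> exists m, clique_color d [set~ a] m.
Proof.
move=> C5 onto /card_geqP[s []].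
case: s => [|s1 [|s2 [|s3 [|s4 [|//]]]]] // us _ sP.
have [x1 /nesym ? e1] : exists2 x, x <> a & d a x = s1.
  by apply/paletteP/sP; rewrite !inE eqxx ?orbT.
have [x2 /nesym ? e2] : exists2 x, x <> a & d a x = s2.
  by apply/paletteP/sP; rewrite !inE eqxx ?orbT.
have [x3 /nesym ? e3] : exists2 x, x <> a & d a x = s3.
  by apply/paletteP/sP; rewrite !inE eqxx ?orbT.
have [x4 /nesym ? e4] : exists2 x, x <> a & d a x = s4.
  by apply/paletteP/sP; rewrite !inE eqxx ?orbT.
have [i iS] := exists_notin (s := [:: s1; s2; s3; s4]) C5.
move: us iS; rewrite /= !inE !negb_or !andbT -!andbA.
do 5![case/andP=> /eqP ?]; move/eqP=> ? /and4P[/eqP ? /eqP ? /eqP ? /eqP ?].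
have [/paletteP[x5 /nesym ? e5]|/paletteP ia] := boolP (i \in palette d a).
  apply: (@five_color_clique a x1 x2 x3 x4 x5) => //.
  by rewrite /= !inE !negb_or !andbT -!andbA; do ?[apply/andP; split]; apply/eqP; congruence.
(* The value [d a a] may still be [i], since the palette ignores it. *)
have {ia} ia z : d a z = i -> z = a.
  by move=> azi; apply/eqP; case: eqP => // ?; case: ia; exists z.
have iaN z : a <> z -> d a z <> i by move=> az /ia/esym.
have [u [v [uv uvi]]] := onto i.
have ua : u <> a by move=> ua; have := ia v; rewrite -ua => /(_ uvi); congruence.
have va : v <> a by move=> va; have := ia u; rewrite dC -va => /(_ uvi); congruence.
have [? ?] : d a u <> i /\ d a v <> i by split=> /ia.
have vui : d v u = i by rewrite dC.
have new y1 y2 y3 y4 t1 t2 t3 t4 : d y1 y2 = i ->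
    star4 d a y1 y2 y3 y4 t1 t2 t3 t4 -> exists m, clique_color d [set~ a] m.
  move=> yi st; exists i; rewrite -yi; apply: (new_color_clique st); rewrite yi.
  have ti y t : a <> y -> d a y = t -> i != t.
    by move=> nay <-; apply/eqP => /esym/ia/esym.
  case: st => -[? ? ? ?] [? ? ? ?] _.
  by rewrite !inE !negb_or; apply/and4P; split; [apply: (ti y1)|apply: (ti y2)|apply: (ti y3)|apply: (ti y4)].

(* When u and v get the same colour from [a], no star contains both. A star through u alone
   suffices: either uw1 or w1w2 has colour [i] and [new] applies, or a path starting with vu is
   rainbow. *)
have same w1 w2 w3 q1 q2 q3 q : d a u = q -> d a v = q ->
    star4 d a u w1 w2 w3 q q1 q2 q3 -> exists m, clique_color d [set~ a] m.
  move=> auq avq st; case: (st) => -[? ? ? ?] [? ? ? ?] [? ? ? [? ? ?]].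
  have [? ? ?] : [/\ i <> q1, i <> q2 & i <> q3].
    by split; [have := @iaN w1|have := @iaN w2|have := @iaN w3] => /(_ ltac:(assumption)); congruence.
  have [[? ?] ?] := (dC u w1, dC v w1, dC w1 w2).
  have [[? ?] [? ?]] := (dC a w1, dC a w2, (dC a u, dC a v)).
  have [uw1|uw1] := d u w1 =P i; first exact: (new u w1 w2 w3 q q1 q2 q3).
  have [w12|?] := d w1 w2 =P i.
    by apply: (new w1 w2 w3 u q1 q2 q3 q) => //; split; split; try split; congruence.
  have [?|?] := d u w1 =P q1.
    have [?|?] := d w1 w2 =P q; first by rainbow_path free v u w1 w2 a.
    have [?|?] := d w1 w2 =P q1; first by rainbow_path free v u a w2 w1.
    by rainbow_path free v u a w1 w2.
  have [?|?] := d u w1 =P q2; first by rainbow_path free v u w1 a w3.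
  by rainbow_path free v u w1 a w2.
have au : a <> u by exact: nesym.
have av : a <> v by exact: nesym.
have star y1 y2 y3 y4 : a <> y1 -> a <> y2 -> a <> y3 -> a <> y4 ->
    d a y1 <> d a y2 -> d a y1 <> d a y3 -> d a y1 <> d a y4 ->
    d a y2 <> d a y3 -> d a y2 <> d a y4 -> d a y3 <> d a y4 ->
    star4 d a y1 y2 y3 y4 (d a y1) (d a y2) (d a y3) (d a y4).
  by move=> *; split; split=> //; split.
have [euv|nuv] := d a u =P d a v.
  have Same w1 w2 w3 := @same w1 w2 w3 _ _ _ _ erefl (esym euv).
  have [?|?] := d a u =P s1; first by apply/Same/(star u x2 x3 x4); congruence.
  have [?|?] := d a u =P s2; first by apply/Same/(star u x1 x3 x4); congruence.
  have [?|?] := d a u =P s3; first by apply/Same/(star u x1 x2 x4); congruence.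
  by apply/Same/(star u x1 x2 x3); congruence.
(* At most two of the colours s1 to s4 occur on au and av, so two of the xi complete u, v to a
   rainbow star. *)
have New w1 w2 := @new u v w1 w2 _ _ _ _ uvi.
have [?|?] := d a u =P s1; have [?|?] := d a v =P s2;
have [?|?] := d a u =P s3; have [?|?] := d a v =P s4;
have [?|?] := d a u =P s2; have [?|?] := d a v =P s1;
have [?|?] := d a u =P s4; have [?|?] := d a v =P s3;
first [ exfalso; congruence
      | by apply/New/(star u v x1 x2); congruence
      | by apply/New/(star u v x1 x3); congruence
      | by apply/New/(star u v x1 x4); congruence
      | by apply/New/(star u v x2 x3); congruence
      | by apply/New/(star u v x2 x4); congruence
      | by apply/New/(star u v x3 x4); congruence].
Qed.

(** * Excluding palettes of size three *)

(** The palette of [v] is filled by c1, c4, c5. A neighbour of [a] by colour c2 or c3 outside u, w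
    then gives a rainbow path through its edge to [v]. So x2, x3 are u, w in some order, and a fifth
    vertex z extends one of the paths a, u, v, w and a, w, v, u. *)
Lemma poor_vertex_no_cherry a v u w x2 x3 c1 c2 c3 c4 c5 :
  4 < #|T| -> palette d a = [set c1; c2; c3] -> #|palette d v| <= 3 ->
  uniq [:: c1; c2; c3; c4; c5] ->
  a <> u -> a <> v -> a <> w -> a <> x2 -> a <> x3 ->
  d a v = c1 -> d a x2 = c2 -> d a x3 = c3 -> d v u = c4 -> d v w = c5 ->
  v <> u -> v <> w -> False.
Proof.
move=> T5 pa pv; rewrite /= !inE !negb_or !andbT -!andbA.
do 9![case/andP=> /eqP ?]; move/eqP=> ? ? ? ? ? ? av ? ? vu vw ? ?.
have pvE : palette d v = [set c1; c4; c5].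
  apply/esym/eqP; rewrite eqEcard; apply/andP; split.
    apply/subsetP => c; rewrite !inE -orbA => /or3P[]/eqP->; apply/paletteP.
    - by exists a; rewrite // dC.
    - by exists u => //; exact: nesym.
    - by exists w => //; exact: nesym.
  by rewrite -setUA cardsU1 cards2 !inE negb_or; do ?case: eqP.
have va z : v <> z -> [\/ d v z = c1, d v z = c4 | d v z = c5].
  move=> vz; have : d v z \in palette d v by apply/paletteP; exists z => //; exact: nesym.
  by rewrite pvE !inE -orbA => /or3P[]/eqP ->; [constructor 1|constructor 2|constructor 3].
have aa z : a <> z -> [\/ d a z = c1, d a z = c2 | d a z = c3].
  move=> vz; have : d a z \in palette d a by apply/paletteP; exists z => //; exact: nesym.
  by rewrite pa !inE -orbA => /or3P[]/eqP ->; [constructor 1|constructor 2|constructor 3].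
have [[? ?] ?] := (dC a v, dC v u, dC v w).
have mid y y' : a <> y -> a <> y' -> d a y <> d a y' ->
    d a y <> c1 -> d a y <> c4 -> d a y <> c5 ->
    d a y' <> c1 -> d a y' <> c4 -> d a y' <> c5 -> y <> u -> y <> w -> False.
  move=> *; have [? ?] := (dC a y, dC a y'); have := dC v y.
  have vy : v <> y by congruence.
  have [? ?|? ?|? ?] := va y vy.
  - have [?|?] := y' =P u; first by rainbow_path free y' a y v w.
    by rainbow_path free y' a y v u.
  - have [?|?] := y' =P w; first by rainbow_path free y a w v u.
    by rainbow_path free y' a y v w.
  - have [?|?] := y' =P u; first by rainbow_path free y a u v w.
    by rainbow_path free y' a y v u.
have [z zN] := exists_notin (s := [:: a; u; v; w]) T5.
move: zN; rewrite !inE !negb_or => /and4P[/eqP ? /eqP ? /eqP ? /eqP ?].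
have ? := dC a z; have az : a <> z by exact: nesym.
have [?|?] := x2 =P u; have [?|?] := x3 =P w.
- by case: (aa _ az) => ?; first [by rainbow_path free z a u v w | by rainbow_path free z a w v u].
- by apply: (mid x3 x2); congruence.
- by apply: (mid x2 x3); congruence.
have [?|?] := x2 =P w; last by apply: (mid x2 x3); congruence.
have [?|?] := x3 =P u; last by apply: (mid x3 x2); congruence.
by case: (aa _ az) => ?; first [by rainbow_path free z a u v w | by rainbow_path free z a w v u].
Qed.

(** Paths joining the two edges through [a] force colour c1 from [a] to all four ends. The four
    edges between uv and u'v' then get colour c1 too, and no colour remains for x2u. *)
Lemma poor_vertex_no_matching a u v u' v' x2 x3 c1 c2 c3 c4 c5 :
  palette d a = [set c1; c2; c3] -> uniq [:: c1; c2; c3; c4; c5] ->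
  uniq [:: u; v; u'; v'] ->
  a <> u -> a <> v -> a <> u' -> a <> v' -> a <> x2 -> a <> x3 ->
  d a u = c1 -> d a x2 = c2 -> d a x3 = c3 -> d u v = c4 -> d u' v' = c5 -> False.
Proof.
move=> pa; rewrite /= !inE !negb_or !andbT -!andbA.
do 9![case/andP=> /eqP ?]; move/eqP=> ?.
do 5![case/andP=> /eqP ?]; move/eqP=> ? au av au' av' ? ? eu ? ? ? ?.
have aa z : a <> z -> [\/ d a z = c1, d a z = c2 | d a z = c3].
  move=> vz; have : d a z \in palette d a by apply/paletteP; exists z => //; exact: nesym.
  by rewrite pa !inE -orbA => /or3P[]/eqP ->; [constructor 1|constructor 2|constructor 3].
have aN z : a <> z -> d a z <> c4 /\ d a z <> c5 by move=> /aa[] ->; split; congruence.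
have [[? ?] [? ?]] := (aN _ au, aN _ av); have [[? ?] [? ?]] := (aN _ au', aN _ av').
have [[? ?] [? ?]] := (dC a u, dC a v, (dC a u', dC a v')).
have [[? ?] [? ?]] := (dC u v, dC u' v', (dC a x2, dC a x3)).
have eu' : d a u' = c1.
  by apply/eqP; case: eqP => // ?; rainbow_path free v u a u' v'.
have ev' : d a v' = c1.
  by apply/eqP; case: eqP => // ?; rainbow_path free v u a v' u'.
have ev : d a v = c1.
  by apply/eqP; case: eqP => // ?; rainbow_path free u v a u' v'.
have cross y y' z z' : d a y = c1 -> d a y' = c1 -> d a z = c1 -> d a z' = c1 ->
  a <> y -> a <> y' -> a <> z -> a <> z' -> y <> y' -> y <> z -> y <> z' -> y' <> z -> y' <> z' -> z <> z' ->
  d y y' = c4 -> d z z' = c5 -> d y' z = c1.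
  move=> *; have [[? ?] [? ?]] := (dC a y, dC a y', (dC a z, dC a z')).
  have [[? ?] [? ?]] := (dC y y', dC z z', (dC a x2, dC a x3)).
  apply/eqP; case: eqP => // ?.
  have [?|?] := d y' z =P c4; last first.
    have [?|?] := d y' z =P c2; first by rainbow_path free x3 a y y' z.
    by rainbow_path free x2 a y y' z.
  have [? ?] := (dC y' z, dC y z).
  by rainbow_path free x2 a z' z y'.
have [vu' uv'] : d v u' = c1 /\ d u v' = c1.
  by split; [apply: (cross u v u' v')|apply: (cross v u v' u')]; congruence.
have [uu' vv'] : d u u' = c1 /\ d v v' = c1.
  by split; [apply: (cross v u u' v')|apply: (cross u v v' u')]; congruence.
have ? := dC x2 u.
have [?|?] := d x2 u =P c1; first by rainbow_path free x3 a x2 u v.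
have [?|?] := d x2 u =P c4; first by rainbow_path free x3 a x2 u u'.
have [?|?] := d x2 u =P c5; first by rainbow_path free x3 a x2 u v.
by rainbow_path free x2 u v v' u'.
Qed.

Lemma poor_palettes_le2 a : 4 < #|T| -> 4 < #|C| ->
  (forall i, exists x y, x <> y /\ d x y = i) ->
  (forall x, #|palette d x| <= 3) -> #|palette d a| <= 2.
Proof.
move=> T5 C5 onto le3; rewrite leqNgt; apply/negP => gt2.
have pa3 : #|palette d a| = 3 by apply/eqP; rewrite eqn_leq le3.
(* Both preceding lemmas need the colour of a given spoke [av] as c1, with x2, x3 representing the
   other two colours. *)
have split_pa v : a <> v -> exists x2 x3,
    [/\ a <> x2, a <> x3, d a v <> d a x2, d a v <> d a x3 & d a x2 <> d a x3] /\
    palette d a = [set d a v; d a x2; d a x3].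
  move=> av; have va : d a v \in palette d a by apply/paletteP; exists v => //; exact: nesym.
  have /cards2P[c2 [c3 [/eqP c23 pE]]] : #|palette d a :\ d a v| == 2.
    by move: pa3; rewrite (cardsD1 (d a v)) va add1n => -[->].
  have /setD1P[/eqP ne2 /paletteP[x2 /nesym ax2 e2]] : c2 \in palette d a :\ d a v.
    by rewrite pE !inE eqxx.
  have /setD1P[/eqP ne3 /paletteP[x3 /nesym ax3 e3]] : c3 \in palette d a :\ d a v.
    by rewrite pE !inE eqxx orbT.
  exists x2, x3; split; first by split; congruence.
  by rewrite -(setD1K va) pE e2 e3 setUA.
have /card_gt1P[c4 [c5 [c4P c5P /eqP c45]]] : 1 < #|~: palette d a|.
  by rewrite -(leq_add2l #|palette d a|) cardsC pa3.
have off i : i \in ~: palette d a -> exists u v,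
    [/\ u <> v, d u v = i & [/\ d v u = i, a <> u & a <> v]].
  rewrite inE => /paletteP iN; have [u [v [uv uvi]]] := onto i.
  exists u, v; split=> //; split; first by rewrite dC.
    by move=> au; apply: iN; exists v; congruence.
  by move=> av; apply: iN; exists u; rewrite 1?dC; congruence.
have [u [v [uv e4 [e4' au av]]]] := off _ c4P.
have [u' [v' [uv' e5 [e5' au' av']]]] := off _ c5P.
have ne c z : c \in ~: palette d a -> a <> z -> d a z <> c.
  by rewrite inE => /paletteP cN az azc; apply: cN; exists z; [exact: nesym|].
have cherry p q r : a <> p -> a <> q -> a <> r -> p <> q -> q <> r -> d q p = c4 -> d q r = c5 -> False.
  move=> ap aq ar pq qr ep er.
  have [x2 [x3 [[a2 a3 n2 n3 n23] pE]]] := split_pa _ aq.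
  apply: (@poor_vertex_no_cherry a q p r x2 x3 (d a q) (d a x2) (d a x3) c4 c5) => //.
    by rewrite /= !inE !negb_or !andbT -!andbA; do ?[apply/andP; split]; apply/eqP => //; exact: ne.
  exact: nesym.
have [?|uu'] := u =P u'; first by apply: (cherry v u v'); congruence.
have [?|uw'] := u =P v'; first by apply: (cherry v u u'); congruence.
have [?|vu'] := v =P u'; first by apply: (cherry u v v'); congruence.
have [?|vv'] := v =P v'; first by apply: (cherry u v u'); congruence.
have [x2 [x3 [[a2 a3 n2 n3 n23] pE]]] := split_pa _ au.
apply: (@poor_vertex_no_matching a u v u' v' x2 x3 (d a u) (d a x2) (d a x3) c4 c5) => //.
  by rewrite /= !inE !negb_or !andbT -!andbA; do ?[apply/andP; split]; apply/eqP => //; exact: ne.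
by rewrite /= !inE !negb_or !andbT -!andbA; do ?[apply/andP; split]; apply/eqP.
Qed.

(** * Palettes of size at most two, and the clique *)

Lemma poor_clique : 4 < #|T| -> 4 < #|C| ->
  (forall i, exists x y, x <> y /\ d x y = i) ->
  (forall x, #|palette d x| <= 2) ->
  exists (A : {set T}) m, #|C| <= #|A|.+1 /\ clique_color d A m.
Proof.
move=> T5 C5 onto le2.
have meet x y : exists2 i, i \in palette d x & i \in palette d y.
  have [<-|xy] := x =P y.
    have /card_gt0P[z] : 0 < #|[set~ x]| by rewrite cardsC1 -subn1 subn_gt0 (leq_trans _ T5).
    by rewrite !inE => /eqP zx; exists (d x z); apply/paletteP; exists z.
  by exists (d x y); apply/paletteP; [exists y; [exact: nesym|]|exists x; rewrite // dC].
have seen i : {x | i \in palette d x}.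
  apply: sigW; have [x [y [xy <-]]] := onto i.
  by exists x; apply/paletteP; exists y => //; exact: nesym.
pose w i := sval (seen i).
have wP i : i \in palette d (w i) := svalP (seen i).
have palE x i j : i \in palette d x -> j \in palette d x -> i <> j ->
    palette d x = [set i; j].
  move=> xi xj /eqP ij; apply/esym/eqP; rewrite eqEcard cards2 ij le2 andbT.
  by apply/subsetP => l /set2P[]->.
(* Three colours i, j, l are missed by x0. The palette of [w i] is i plus some m seen at x0, and
   since palettes meet, those of [w j] and [w l] also contain m. A palette without m would have to
   contain i, j and l. *)
have [m mP] : exists m, forall x, m \in palette d x.
  have /card_gt0P[x0 _] : 0 < #|T| by apply: leq_trans T5.
  have : 2 < #|~: palette d x0|.
    rewrite -(leq_add2l #|palette d x0|) cardsC (leq_trans _ C5) //.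
    exact: leq_add (le2 x0) (leqnn 3).
  case/card_gt2P=> i [j [l [[iP jP lP] [/eqP ij /eqP jl /eqP li]]]].
  have [m mi mx0] := meet (w i) x0.
  have pal1 j' : j' \in ~: palette d x0 -> i <> j' -> m \in palette d (w j').
    move=> j'P ij'; have [p pj px0] := meet (w j') x0.
    have [q qj qi] := meet (w j') (w i).
    have jp : j' <> p by move=> E; move: j'P; rewrite inE E px0.
    have im : i <> m by move=> E; move: iP; rewrite inE E mx0.
    move: qj qi; rewrite (palE _ _ _ (wP j') pj jp) (palE _ _ _ (wP i) mi im) !inE.
    move=> /orP[]/eqP-> /orP[]/eqP E; rewrite ?E ?eqxx ?orbT //; first by congruence.
    by move: iP; rewrite inE -E px0.
  exists m => z; apply: contraT => mz.
  have zin i' : i' \in ~: palette d x0 -> m \in palette d (w i') -> i' \in palette d z.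
    move=> i'P mi'; have [p pz] := meet z (w i').
    have im : i' <> m by move=> E; move: i'P; rewrite inE E mx0.
    rewrite (palE _ _ _ (wP i') mi' im) !inE => /orP[]/eqP E; first by rewrite -E.
    by move: mz; rewrite -E pz.
  have : 2 < #|palette d z|.
    apply/card_gt2P; exists i, j, l; split; last by split; exact/eqP.
    by split; apply: zin => //; apply: pal1 => //; exact: nesym.
  by rewrite ltnNge le2.
(* The palette of [w i] is {i, m}: this makes [w] injective on the colours other than m, and two
   such palettes share only m. *)
exists (w @: [set~ m]), m; split.
  rewrite card_in_imset ?cardsC1 ?leqSpred // => i j; rewrite !inE => /eqP im /eqP jm wij.
  have := wP j; rewrite -wij (palE _ _ _ (wP i) (mP _) im) !inE.
  by case/orP=> /eqP.
move=> x y /imsetP[i]; rewrite !inE => /eqP im -> /imsetP[j].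
rewrite !inE => /eqP jm -> wij.
have di : d (w i) (w j) \in palette d (w i) by apply/paletteP; exists (w j) => //; exact: nesym.
have dj : d (w i) (w j) \in palette d (w j) by apply/paletteP; exists (w i); rewrite 1?dC.
move: di dj; rewrite (palE _ _ _ (wP i) (mP _) im) (palE _ _ _ (wP j) (mP _) jm) !inE.
by move=> /orP[]/eqP-> // /orP[]/eqP // E; case: wij; rewrite E.
Qed.

Lemma rainbow_P5_free_clique : 4 < #|T| -> 4 < #|C| ->
  (forall i, exists x y, x <> y /\ d x y = i) ->
  exists (A : {set T}) m, #|C| <= #|A|.+1 /\ clique_color d A m.
Proof.
move=> T5 C5 onto.
have [/existsP[a rich]|/existsPn poor] := boolP [exists a, 3 < #|palette d a|]; last first.
  apply: poor_clique => // x; apply: poor_palettes_le2 => // y.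
  by rewrite leqNgt poor.
have [m mP] := rich_vertex_clique C5 onto rich.
exists [set~ a], m; split=> //.
(* Every colour but m appears only on edges at [a], which number at most the size of the clique. *)
have -> : #|C| = #|m |: palette d a|.
  rewrite -cardsT; congr #|pred_of_set _|; apply/esym/setP => i; rewrite !inE.
  have [x [y [xy <-]]] := onto i.
  have [ax|xa] := x =P a.
    by apply/orP; right; apply/paletteP; exists y; [move=> ya; apply: xy; rewrite ya|rewrite -ax].
  have [ay|ya] := y =P a.
    by apply/orP; right; apply/paletteP; exists x; rewrite // ay dC.
  by rewrite mP ?eqxx // !inE; apply/eqP.
rewrite cardsU1 (leq_trans (leq_add (leq_b1 _) (leqnn _))) // add1n ltnS.
exact: leq_imset_card.
Qed.
End RainbowP5Free.

(** * Copies in complete graphs and the upper bound *)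

Lemma edgesP (G : sgraph) (e : {set G}) :
  reflect (exists x y, adj x y /\ e = [set x; y]) (e \in edges G).
Proof.
apply: (iffP imsetP) => [[[x y]]|[x [y [xy ->]]]].
  by rewrite inE /= => xy ->; exists x, y.
by exists (x, y); rewrite ?inE.
Qed.

Lemma edges_complete n : edges (complete_graph n) = [set e : {set complete_graph n} | #|e| == 2].
Proof.
apply/setP => e; rewrite inE; apply/edgesP/cards2P.
  by move=> [x [y [xy ->]]]; exists x, y.
by move=> [x [y [xy ->]]]; exists x, y.
Qed.

Lemma card_edge (G : sgraph) (e : {set G}) : e \in edges G -> #|e| = 2.
Proof.
case/edgesP=> x [y [xy ->]]; rewrite cards2.
by case: eqP xy => // ->; rewrite adj_irrefl.
Qed.

Lemma complete_copy n (H : sgraph) (f : H -> complete_graph n) : injective f ->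
  is_copy H (f @: [set: H]) [set f @: e | e : {set H} in edges H].
Proof.
move=> f_inj; split; last by exists f.
apply/subsetP => _ /imsetP[e eH ->].
by rewrite edges_complete inE card_imset // (card_edge eH).
Qed.

Lemma rainbow_path_copy k n (c : {set complete_graph n} -> 'I_k)
    (x : complete_graph n) (p : seq (complete_graph n)) :
  uniq (x :: p) -> uniq (pairmap (fun y z => c [set y; z]) x p) ->
  has_rainbow_copy c (path_graph (size p).+1).
Proof.
move=> uxp ucol.
pose f (i : path_graph (size p).+1) := nth x (x :: p) i.
have f_inj : injective f.
  by move=> i j /eqP; rewrite nth_uniq ?ltn_ord // => /eqP/val_inj.
exists (f @: setT), [set f @: e | e : {set path_graph (size p).+1} in edges (path_graph (size p).+1)].
split; first exact: complete_copy.
(* Indexing each edge by its position on the path reduces injectivity of the colouring to [ucol]. *)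
have FE e : e \in [set f @: e | e : {set path_graph (size p).+1} in edges (path_graph (size p).+1)] ->
    exists2 i, i < size p & e = [set nth x (x :: p) i; nth x p i].
  case/imsetP=> _ /edgesP[a [b [ab ->]] ->]; rewrite imsetU1 imset_set1 /f.
  case/orP: ab => /eqP ab; [exists a|exists b; rewrite 1?setUC].
  - by rewrite -ltnS ab ltn_ord.
  - by rewrite -ab.
  - by rewrite -ltnS ab ltn_ord.
  - by rewrite -ab.
move=> e1 e2 /FE[i ip ->] /FE[j jp ->] cij; suff -> : i = j by [].
apply/eqP; rewrite -(nth_uniq (c set0) _ _ ucol) ?size_pairmap //.
by rewrite !(nth_pairmap x) // cij.
Qed.

Lemma mono_clique_copy k n (c : {set complete_graph n} -> 'I_k) (H : sgraph)
    (A : {set complete_graph n}) (m : 'I_k) :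
  #|H| <= #|A| -> clique_color (fun x y => c [set x; y]) A m -> has_mono_copy c H.
Proof.
move=> HA mono; pose f (h : H) : complete_graph n := enum_val (widen_ord HA (enum_rank h)).
have f_inj : injective f.
  by move=> g h /enum_val_inj/(congr1 val)/= /val_inj/enum_rank_inj.
exists (f @: setT), [set f @: e | e : {set H} in edges H].
split; first exact: complete_copy.
exists m => _ /imsetP[_ /edgesP[x [y [xy ->]]] ->].
rewrite imsetU1 imset_set1; apply: mono; try exact: enum_valP.
by move=> /f_inj E; move: xy; rewrite E adj_irrefl.
Qed.

(** The limit 10 is the number of edges of K_5, and the monochromatic clique has at least k - 1
    vertices, enough for [H]. *)
Lemma gr_bound5 k (H : sgraph) : 5 <= k <= 10 -> #|H| < k -> gr_bound k (path_graph 5) H 5.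
Proof.
case/andP=> k5 k10 Hk; split=> [|n n5 c onto]; first exact: k10.
pose d (x y : complete_graph n) := c [set x; y].
have [/existsP[x /existsP[p /andP[uxp ucol]]]|/existsPn rf] :=
    boolP [exists x, exists p : 4.-tuple (complete_graph n),
             uniq (x :: p) && uniq (pairmap d x p)].
  by left; have := rainbow_path_copy uxp ucol; rewrite size_tuple.
right; have [|||||A [m [kA mono]]] := @rainbow_P5_free_clique (complete_graph n) 'I_k d.
- move=> x p sp uxp; have /existsPn/(_ (Tuple (introT eqP sp))) := rf x.
  by rewrite uxp.
- by move=> x y; rewrite /d setUC.
- by rewrite card_ord.
- by rewrite card_ord.
- by move=> i; have [e /edgesP[x [y [/eqP xy ->]]] <-] := onto i; exists x, y.
apply: mono_clique_copy mono.
by rewrite -ltnS (leq_trans Hk) // -[k in k <= _]card_ord.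
Qed.

(** * Colourings of K_4 and the lower bound *)

(** List [E] with [e0] first and [e1] last, and colour by position modulo k. With at most k + 1
    positions, only the first and the last can agree. *)
Lemma merging_coloring (X : finType) (E : {set X}) k e0 e1 :
  k <= #|E| <= k.+1 -> e0 \in E -> e1 \in E -> e0 <> e1 -> 1 < k ->
  exists c : X -> 'I_k, (forall i, exists2 e, e \in E & c e = i) /\
    {in E &, forall e e', e <> e' -> c e = c e' -> [set e; e'] = [set e0; e1]}.
Proof.
case: k => [|k] // /andP[Ek kE] e0E e1E /eqP e01 k1.
pose L := e0 :: rcons (enum (E :\ e0 :\ e1)) e1.
have sL : size L = #|E|.
  by rewrite /L /= size_rcons -cardE (cardsD1 e0 E) e0E (cardsD1 e1 (E :\ e0)) !inE eq_sym e01 e1E.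
have uL : uniq L.
  by rewrite /L /= rcons_uniq mem_rcons !inE !mem_enum !inE !eqxx !andbF negb_or e01 enum_uniq.
have memL e : (e \in L) = (e \in E).
  rewrite /L !inE mem_rcons !inE mem_enum !inE.
  by case: eqVneq => [->|_]; rewrite ?e0E ?orbT //=; case: eqVneq => [->|_]; rewrite ?e1E ?orbT.
have idx e : e \in E -> index e L < #|E| by rewrite -memL -sL index_mem.
exists (fun e => inord (index e L %% k.+1)); split.
  move=> i; have iL : i < size L by rewrite sL (leq_trans (ltn_ord i)).
  exists (nth e0 L i); first by rewrite -memL mem_nth.
  by rewrite index_uniq // modn_small // inord_val.
have ends e e' : e \in E -> e' \in E -> index e L < index e' L ->
    index e L = index e' L %[mod k.+1] -> [set e; e'] = [set e0; e1].
  move=> eE e'E lt eqm.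
  have e'k : index e' L <= k.+1 by rewrite -ltnS (leq_trans (idx _ e'E)).
  have e'0 : index e' L = k.+1.
    apply/eqP; rewrite eqn_leq e'k leqNgt; apply: contraL lt => lt'.
    move: eqm; rewrite (modn_small lt') => <-; rewrite -leqNgt; exact: leq_mod.
  have e0' : index e L = 0.
    by move: eqm; rewrite e'0 modnn modn_small // -e'0.
  have -> : e = e0 by rewrite -(nth_index e0 (_ : e \in L)) ?memL // e0'.
  suff -> : e' = e1 by [].
  rewrite -(nth_index e0 (_ : e' \in L)) ?memL // e'0.
  (* Position k.+1 exists, so [E] has the maximal size k.+2 and this position is the last one. *)
  have -> : k.+1 = (size L).-1.
    have := idx _ e'E; rewrite e'0 sL => lt'.
    by rewrite (_ : #|E| = k.+2) //; apply/eqP; rewrite eqn_leq kE.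
  by rewrite nth_last /= last_rcons.
move=> e e' eE e'E ee' /(congr1 val); rewrite /= !inordK ?ltn_mod // => eqm.
have [lt|lt|eqi] := ltngtP (index e L) (index e' L).
- exact: ends.
- by rewrite setUC; apply: ends.
by case: ee'; rewrite -[e](nth_index e0 (_ : e \in L)) ?memL // eqi nth_index ?memL.
Qed.

Lemma no_gr_bound4 k M (H : sgraph) : M <= 4 -> 5 <= k <= 6 ->
  1 < #|edges H| \/ 4 < #|H| -> ~ gr_bound k (path_graph 5) H M.
Proof.
move=> M4 /andP[k5 k6] hH [_ /(_ 4 M4) bound].
set K := complete_graph 4 in bound.
have E6 : #|edges K| = 6 by rewrite edges_complete card_draws card_ord.
have pair_edge (x y : 'I_4) : x != y -> [set x; y] \in edges K.
  by move=> xy; apply/edgesP; exists x, y.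
(* Colouring K_4 so that only [e0] and [e1] may share a colour, any two edges
   of H are mapped onto [e0] and [e1]. *)
have copied (e0 e1 : {set K}) : e0 \in edges K -> e1 \in edges K -> e0 <> e1 ->
    #|H| <= 4 /\ {in edges H &, forall e e', e <> e' ->
                   (e :&: e' == set0) = (e0 :&: e1 == set0)}.
  move=> e0E e1E e01; have kE : k <= #|edges K| <= k.+1 by rewrite E6 k6 ltnS.
  have [c [onto merge]] := merging_coloring kE e0E e1E e01 (leq_trans (isT : 1 < 5) k5).
  case: (bound c onto) => -[W [F [[FK [f [f_inj _ FE]]] cF]]].
    by have := leq_card f f_inj; rewrite (card_ord 5) (card_ord 4).
  split; first by have := leq_card f f_inj; rewrite (card_ord 4).
  move=> e e' eH e'H ee'; case: cF => i mono.
  have fF h : h \in edges H -> f @: h \in F by move=> hH'; rewrite FE; apply: imset_f.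
  have fne : f @: e <> f @: e' by move=> /(imset_inj f_inj).
  have := merge _ _ (subsetP FK _ (fF _ eH)) (subsetP FK _ (fF _ e'H)) fne.
  rewrite !mono ?fF // => /(_ erefl) pE.
  rewrite -(imset_eq0 f) imsetI; last by move=> x y _ _; apply: f_inj.
  have : f @: e \in [set e0; e1] by rewrite -pE !inE eqxx.
  have : f @: e' \in [set e0; e1] by rewrite -pE !inE eqxx orbT.
  rewrite !inE => /orP[]/eqP E' /orP[]/eqP E; rewrite E E' // in fne *.
  by rewrite setIC.
pose v0 : 'I_4 := inord 0; pose v1 : 'I_4 := inord 1.
pose v2 : 'I_4 := inord 2; pose v3 : 'I_4 := inord 3.
have vE : (v0 : nat, v1 : nat, v2 : nat, v3 : nat) = (0, 1, 2, 3) by rewrite !inordK.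
case: vE => V0 V1 V2 V3.
have e01 : [set v0; v1] \in edges K by apply: pair_edge; rewrite -val_eqE /= V0 V1.
have e02 : [set v0; v2] \in edges K by apply: pair_edge; rewrite -val_eqE /= V0 V2.
have e23 : [set v2; v3] \in edges K by apply: pair_edge; rewrite -val_eqE /= V2 V3.
have ne x y z (e : {set K}) : z \in [set x; y] -> z \notin e -> [set x; y] <> e :> {set K}.
  by move=> ze zN E; move: zN; rewrite -E ze.
have [|H4 adjacent] := copied _ _ e01 e02.
  by apply: (ne v0 v1 v1); rewrite !inE -!val_eqE /= ?V0 ?V1 ?V2.
have [|_ disj] := copied _ _ e01 e23.
  by apply: (ne v0 v1 v1); rewrite !inE -!val_eqE /= ?V0 ?V1 ?V2 ?V3.
case: hH => [/card_gt1P[e [e' [eH e'H /eqP ee']]]|]; last by rewrite ltnNge H4.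
(* The same two edges of [H] would have to meet by the first colouring and be disjoint by the
   second. *)
move: (adjacent _ _ eH e'H ee'); rewrite (disj _ _ eH e'H ee').
have -> : [set v0; v1] :&: [set v2; v3] == set0 :> {set K}.
  apply/eqP/setP => x; rewrite !inE; apply/negP => /andP[/orP[]/eqP->].
    by rewrite -!val_eqE /= V0 V2 V3.
  by rewrite -!val_eqE /= V1 V2 V3.
by move/esym/eqP/setP/(_ v0); rewrite !inE eqxx.
Qed.

Theorem theorem2p2 (k t : nat) (H : sgraph)
    (hk : k = 5 \/ k = 6) (hkt : t + 1 <= k) (ht : 3 <= t)
    (hH : nonempty H) (hord : #|H| = t)
    (* excludes only K_2 plus one or two isolated vertices, where gr_k is 4 *)
    (hexc : ~ (#|edges H| = 1 /\ t <= 4)) :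
  is_gallai_ramsey k (path_graph 5) H 5.
Proof.
have k56 : 5 <= k <= 6 by case: hk => ->.
split; first by apply: gr_bound5; [case: hk => ->|rewrite hord -addn1].
move=> M bound; rewrite leqNgt; apply/negP => M5.
apply: (no_gr_bound4 _ k56 _ bound) => //.
have [t4|t5] := leqP t 4; last by right; rewrite hord.
left; rewrite ltn_neqAle card_gt0 [_ != set0]hH andbT eq_sym.
by apply/eqP => e1; apply: hexc.
Qed.
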